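(* Let $D$ be a strong digraph different from the directed cycle of length $3$, and let $L(D)$ be its line digraph. Then $$smc_v(L(D)) = smc(D).$$
   Context: All digraphs are simple (no parallel arcs and no loops); all paths and cycles are directed. A digraph is strong (strongly connected) if for every pair of vertices $u,v$, each is reachable from the other. The line digraph $L(D)$ of a digraph $D=(V,A)$ has vertex set $A$, and $(e,f)$ is an arc of $L(D)$ whenever the head of $e$ is the tail of $f$. An arc-coloring of a strong digraph $D$ is a strongly monochromatic connecting coloring (SMC-coloring) if for every pair $u,v$ of vertices of $D$ there exist a directed $(u,v)$-path all of whose arcs have the same color and a directed $(v,u)$-path all of whose arcs have the same color. $smc(D)$ denotes the maximum number of colors used in an SMC-coloring of $D$. A directed path in a vertex-colored digraph is vertex-monochromatic if all its internal vertices have the same color (so paths with at most one internal vertex are always vertex-monochromatic). A vertex-coloring of a strong digraph is a strongly vertex-monochromatic connecting coloring (SVMC-coloring) if for every pair $u,v$ of vertices there exist a directed $(u,v)$-vertex-monochromatic path and a directed $(v,u)$-vertex-monochromatic path. $smc_v(D)$ denotes the maximum number of colors used in an SVMC-coloring of the strong digraph $D$. Colorings need not be proper. *)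

(* Defs.v *)
From mathcomp Require Import all_boot.
From mathcomp Require Import boolp.

Set Implicit Arguments.
Unset Strict Implicit.
Unset Printing Implicit Defensive.

(* Finite and without loops; [arc] being a relation excludes parallel arcs,   *)
(* whereas a pair of opposite arcs is allowed.                                *)
Record digraph := Digraph {
  vertex :> finType;
  arc : rel vertex;
  arc_irr : irreflexive arc }.

Definition strong (D : digraph) := forall u v : D, connect (@arc D) u v.

Definition isomorphic (D E : digraph) :=
  exists2 f : D -> E, bijective f & forall x y, arc (f x) (f y) = arc x y.

Definition dicycle3_arc : rel 'I_3 := [rel i j | j == ordS i].

Fact dicycle3_irr : irreflexive dicycle3_arc.
Proof. by case=> [[|[|[|]]]]. Qed.

Definition dicycle3 : digraph := Digraph dicycle3_irr.

Definition arcs (D : digraph) : finType := {e : D * D | arc e.1 e.2}.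

Definition tail (D : digraph) (e : arcs D) : D := (sval e).1.
Definition head (D : digraph) (e : arcs D) : D := (sval e).2.

Definition line_arc (D : digraph) : rel (arcs D) :=
  [rel e f | head e == tail f].

Fact line_irr (D : digraph) : irreflexive (@line_arc D).
Proof.
case=> [[u v] /= uv]; apply/negP; rewrite /line_arc /head /tail /= => /eqP vu.
by move: uv; rewrite vu arc_irr.
Qed.

Definition line_digraph (D : digraph) : digraph := Digraph (@line_irr D).

(* The path visits u and then, in order, the vertices of p. The path from u   *)
(* to itself with p empty is allowed.                                         *)
Definition dipath (D : digraph) (u v : D) (p : seq D) : Prop :=
  [/\ path (@arc D) u p, last u p = v & uniq (u :: p)].

Definition traverses (D : digraph) (u : D) (p : seq D) : pred (arcs D) :=
  [pred e | (tail e, head e) \in zip (u :: p) p].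

(* For a path visiting u and then p: neither u nor the last vertex.           *)
Definition internal (D : digraph) (u : D) (p : seq D) : seq D :=
  behead (belast u p).

Definition mono_connected (D : digraph) (C : Type) (c : arcs D -> C) (u v : D) :=
  exists2 p : seq D, dipath u v p &
    {in traverses u p &, forall e f, c e = c f}.

Definition vmono_connected (D : digraph) (C : Type) (c : D -> C) (u v : D) :=
  exists2 p : seq D, dipath u v p &
    {in internal u p &, forall x y, c x = c y}.

Definition SMC_coloring (D : digraph) (C : Type) (c : arcs D -> C) :=
  forall u v : D, mono_connected c u v /\ mono_connected c v u.

Definition SVMC_coloring (D : digraph) (C : Type) (c : D -> C) :=
  forall u v : D, vmono_connected c u v /\ vmono_connected c v u.

(* A coloring of n objects uses at most n colors, so in both maxima a palette *)
(* of n colors is enough. Without objects to color the maximum is 0.          *)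
Definition smc (D : digraph) : nat :=
  \max_(c : {ffun arcs D -> 'I_#|arcs D|} | `[< SMC_coloring c >])
     #|[set c e | e : arcs D]|.

Definition smc_v (D : digraph) : nat :=
  \max_(c : {ffun D -> 'I_#|D|} | `[< SVMC_coloring c >])
     #|[set c x | x : D]|.

(* Main.v *)
From mathcomp Require Import all_boot.
From mathcomp Require Import boolp.
Require Import Defs.

Set Implicit Arguments.
Unset Strict Implicit.
Unset Printing Implicit Defensive.

(** A coloring [c] of the arcs of [D] is literally a coloring of the vertices
    of [L(D)], and the two maxima range over the same finite functions.  The
    theorem holds because, for a strong [D] other than the 3-cycle, [c] is an
    SMC-coloring of [D] if and only if it is an SVMC-coloring of [L(D)]
    ([SVMC_line_digraph]).

    From [D] to [L(D)]: a monochromatic path from the head of [e] to the tail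
    of [f], read as a sequence of arcs, is the interior of a walk from [e] to
    [f] in [L(D)] ([link_vmono]); a path extracted from this walk has its
    interior among the same arcs.

    From [L(D)] to [D]: given [u <> v], choose an arc [e] into [u] and an arc
    [f] out of [v].  If [e <> f], the interior of a vertex-monochromatic path
    from [e] to [f] is a monochromatic walk from [u] to [v]
    ([vmono_link]).  This choice is impossible only if the arc [vu] is both
    the only arc into [u] and the only arc out of [v] ([forced_arc]).  Then
    every walk entering [u] from a third vertex ends with [vu], and every walk
    leaving [v] for a third vertex starts with [vu].  So if some third vertex
    [q] has monochromatic walks from [v] to [q] and from [q] to [u], both have
    the color of [vu], and without that arc they compose to a monochromatic
    walk from [u] to [v] ([link_through]).  Suppose that there is no such [q]
    and that [uv] is not an arc.  Then [uq] or [qv] is a forced arc for every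
    third vertex [q], which leaves only the cycles of length 3 and 4; in the
    latter the walks between vertices at distance 2 already force all the
    colors needed to agree ([link_across_forced_arc]). *)

(** * Walks in a finite relation *)

Lemma path_zip (T : eqType) (r : rel T) (u : T) (p : seq T) :
  path r u p = all (fun xy => r xy.1 xy.2) (zip (u :: p) p).
Proof. by elim: p u => //= y p IHp u; rewrite IHp. Qed.

Lemma connect_first_step (T : finType) (r : rel T) (u v : T) :
  connect r u v -> u != v -> exists2 w, r u w & connect r w v.
Proof.
case/connectP=> [[|w p] /= + ->]; first by rewrite eqxx.
by case/andP=> uw wp _; exists w => //; apply/connectP; exists p.
Qed.

Lemma connect_last_step (T : finType) (r : rel T) (u v : T) :
  connect r u v -> u != v -> exists2 w, connect r u w & r w v.
Proof.
case/connectP=> p; case/lastP: p => [|p w] /=; first by move=> _ ->; rewrite eqxx.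
rewrite rcons_path last_rcons => /andP[up pw] -> _.
by exists (last u p) => //; apply/connectP; exists p.
Qed.

(** * Monochromatic walks *)

Section Links.
Variables (D : digraph) (C : eqType) (c : arcs D -> C).

Definition colored_arc (k : C) : rel D :=
  fun x y => [exists e : arcs D, [&& tail e == x, head e == y & c e == k]].

Definition link (k : C) : rel D := connect (colored_arc k).

Lemma colored_arcP k x y :
  reflect (exists e, [/\ tail e = x, head e = y & c e = k]) (colored_arc k x y).
Proof.
apply: (iffP existsP) => -[e].
  by case/and3P=> /eqP ? /eqP ? /eqP ?; exists e.
by case=> /eqP ? /eqP ? /eqP ?; exists e; apply/and3P.
Qed.

Lemma arc_ends (e : arcs D) : arc (tail e) (head e).
Proof. by case: e. Qed.

Lemma arc_eq (e f : arcs D) : tail e = tail f -> head e = head f -> e = f.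
Proof.
by case: e f => [[a b] ?] [[x y] ?]; rewrite /tail /head /= => *; apply: val_inj;
   congr pair.
Qed.

Lemma arc_of (x y : D) : arc x y -> exists e : arcs D, tail e = x /\ head e = y.
Proof. by move=> xy; exists (exist _ (x, y) xy). Qed.

Lemma colored_arc_arc k x y : colored_arc k x y -> arc x y.
Proof. by case/colored_arcP=> e [<- <- _]; apply: arc_ends. Qed.

Lemma colored_arc_inj k k' x y :
  colored_arc k x y -> colored_arc k' x y -> k = k'.
Proof.
case/colored_arcP=> e [et eh <-] /colored_arcP[f [ft fh <-]].
by rewrite (arc_eq (e := e) (f := f)) // ?et ?eh.
Qed.

(** Trading paths for walks of a fixed color makes connections composable. *)
Lemma mono_connectedP (u v : D) :
  mono_connected c u v <-> u = v \/ exists k, link k u v.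
Proof.
split.
  case=> -[|y p] [/= up upv _] cp; first by left.
  right; have /andP[/arc_of[e [et eh]] _] := up.
  exists (c e); apply/connectP; exists (y :: p) => //.
  have zip_e : e \in traverses u (y :: p) by rewrite inE et eh mem_head.
  rewrite path_zip; apply/allP=> -[a b] zip_ab.
  have /allP/(_ _ zip_ab)/arc_of[f [/= ft fh]] :
    all (fun xy => @arc D xy.1 xy.2) (zip (u :: y :: p) (y :: p)).
    by rewrite -path_zip.
  apply/colored_arcP; exists f; split=> //.
  by apply: cp => //; rewrite inE ft fh.
case=> [->|[k /connectP[p0 up0 ->]]]; first by exists [::].
case: (shortenP up0) => p up p_uniq _; exists p.
  by split=> //; apply: sub_path up => x y; apply: colored_arc_arc.
have ck e : e \in traverses u p -> c e = k.
  rewrite inE => zip_e; move: up; rewrite path_zip => /allP/(_ _ zip_e) /=.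
  by case/colored_arcP=> f [/arc_eq ef /ef <-].
by move=> e f /ck-> /ck->.
Qed.

(** * Walks in the line digraph *)

Lemma line_path_link k (g : arcs D) (s : seq (arcs D)) :
  path (@line_arc D) g s -> all (fun e => c e == k) (g :: s) ->
  link k (tail g) (head (last g s)).
Proof.
elim: s g => [|h s IHs] g /=.
  move=> _ /andP[/eqP cg _]; apply/connect1/colored_arcP.
  by exists g.
case/andP=> /eqP gh hs /andP[/eqP cg ck].
apply: (@connect_trans _ _ (tail h)); last exact: IHs.
by apply/connect1/colored_arcP; exists g.
Qed.

(** As [e] and [f] are neither equal nor consecutive, the interior of the path
    is nonempty, and its color is well defined. *)
Lemma vmono_link (e f : arcs D) :
    e != f -> head e != tail f ->
    vmono_connected (D := line_digraph D) c e f ->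
  exists k, link k (head e) (tail f).
Proof.
move=> ef e_f [[|g p] [/= + last_f _]]; first by move: ef; rewrite -last_f eqxx.
case/andP=> /eqP eg; rewrite /internal /= => gp cp; move: last_f gp cp.
case/lastP: p => [/= gf|p h] /=; first by rewrite eg gf eqxx in e_f.
rewrite last_rcons rcons_path belast_rcons => -> /andP[gp /eqP <-] cp.
exists (c g); rewrite eg; apply: line_path_link => //.
by apply/allP=> h' h'p; apply/eqP/cp => //; apply: mem_head.
Qed.

Lemma link_line_walk k (e f : arcs D) :
    link k (head e) (tail f) ->
  exists2 s, all (fun g => c g == k) s & path (@line_arc D) e (rcons s f).
Proof.
case/connectP=> p; elim: p e => [|y p IHp] e /=.
  by move=> _ ef; exists [::] => //=; rewrite /line_arc /= ef eqxx.
case/andP=> /colored_arcP[g [eg gy cg]] yp last_f.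
have [||s cs gs] := IHp g; rewrite ?gy //.
by exists (g :: s); rewrite /= ?cg ?eqxx // /line_arc /= eg eqxx.
Qed.

Lemma link_vmono k (e f : arcs D) :
  link k (head e) (tail f) -> vmono_connected (D := line_digraph D) c e f.
Proof.
case/link_line_walk=> s cs es.
have last_f : last e (rcons s f) = f by rewrite last_rcons.
case: (shortenP es) last_f => p ep p_uniq sub_p last_f; exists p => //.
suff ck g : g \in internal (D := line_digraph D) e p -> c g = k.
  by move=> g h /ck-> /ck->.
(* The interior omits [f] as the vertices are distinct, so it lies in [s]. *)
case/lastP: p last_f p_uniq sub_p {ep} => [//|p h].
rewrite last_rcons /internal belast_rcons /= rcons_uniq => ->.
case/and3P=> _ f_p _ sub_p gp; apply/eqP/(allP cs).
have /sub_p : g \in rcons p f by rewrite mem_rcons inE gp orbT.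
by rewrite mem_rcons inE => /orP[/eqP gf|//]; rewrite -gf gp in f_p.
Qed.

End Links.

(** * Forced arcs *)

Section ForcedArcs.
Variable D : digraph.

(** Exactly the arcs [vu] for which no arc into [u] differs from an arc out
    of [v]. *)
Definition forced_arc (v u : D) : Prop :=
  [/\ arc v u, forall x, arc x u -> x = v & forall y, arc v y -> y = u].

Hypothesis D_strong : strong D.

Lemma out_neighbor (u v : D) : u != v -> exists w, arc u w.
Proof. by case/(connect_first_step (D_strong u v)) => w; exists w. Qed.

Lemma in_neighbor (u v : D) : u != v -> exists w, arc w v.
Proof. by case/(connect_last_step (D_strong u v)) => w; exists w. Qed.

Lemma arc_neq (x y : D) : arc x y -> x != y.
Proof. by apply: contraTneq => ->; rewrite arc_irr. Qed.

Lemma cycle3_isomorphic (u v w : D) :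
    (forall z, [|| z == u, z == v | z == w]) ->
    arc v u -> arc u w -> arc w v -> ~~ arc u v -> ~~ arc w u -> ~~ arc v w ->
  isomorphic D dicycle3.
Proof.
move=> cover vu uw wv /negbTE uv /negbTE wu /negbTE vw.
have /negbTE v_u := arc_neq vu; have /negbTE u_w := arc_neq uw.
have /negbTE w_v := arc_neq wv.
pose f z : 'I_3 := if z == v then inord 0 else if z == u then inord 1 else inord 2.
pose g (i : 'I_3) := if i == 0 :> nat then v else if i == 1 :> nat then u else w.
have fv : f v = inord 0 by rewrite /f eqxx.
have fu : f u = inord 1 by rewrite /f eq_sym v_u eqxx.
have fw : f w = inord 2 by rewrite /f w_v eq_sym u_w.
exists f.
  exists g => [z|i].
    by case/or3P: (cover z) => /eqP->; rewrite ?fu ?fv ?fw /g inordK.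
  by apply: val_inj; case: i => -[|[|[|]]] //= lti;
    rewrite /g /= ?fu ?fv ?fw inordK.
move=> x y; rewrite -[LHS]/(f y == ordS (f x)) -val_eqE /=.
case/or3P: (cover x) => /eqP->; case/or3P: (cover y) => /eqP->;
  rewrite ?arc_irr ?uv ?wu ?vw ?vu ?uw ?wv ?fu ?fv ?fw;
  by rewrite !inordK.
Qed.

Variables (C : eqType) (c : arcs D -> C).
Hypothesis c_SVMC : SVMC_coloring (D := line_digraph D) c.

Lemma link_or_forced_arc (u v : D) :
  u != v -> (exists k, link c k u v) \/ forced_arc v u.
Proof.
move=> u_v.
case: (pickP [pred ef : arcs D * arcs D |
              [&& head ef.1 == u, tail ef.2 == v & ef.1 != ef.2]]).
  case=> e f /= /and3P[/eqP eu /eqP fv ef]; left.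
  rewrite -eu -fv; apply: vmono_link => //; first by rewrite eu fv.
  by case: (c_SVMC e f).
move=> no_pair; right.
have same e f : head e = u -> tail f = v -> e = f.
  move=> eu fv; have := no_pair (e, f); rewrite /= eu fv !eqxx /=.
  by move/negbFE/eqP.
have v_u : v != u by rewrite eq_sym.
have [x /arc_of[e [ex eu]]] := in_neighbor v_u.
have [y /arc_of[f [fv fy]]] := out_neighbor v_u.
have ef := same e f eu fv.
split=> [|z /arc_of[g [<- gu]]|z /arc_of[g [gv <-]]].
- by rewrite -eu -fv -ef arc_ends.
- by rewrite (same g f).
- by rewrite -(same e g).
Qed.

(** The color of the forced arc [vu] is carried by all walks that go through
    it, so a third vertex [q] splits the connection from [u] to [v]. *)
Lemma link_through (u v q : D) k k' :
    forced_arc v u -> q != u -> q != v -> link c k q u -> link c k' v q ->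
  link c k u v.
Proof.
case=> vu in_u out_v q_u q_v qu vq.
have [x qx xu] := connect_last_step qu q_u.
have [y vy yq] : exists2 y, colored_arc c k' v y & link c k' y q.
  by apply: connect_first_step vq _; rewrite eq_sym.
have xv := in_u _ (colored_arc_arc xu); rewrite xv in qx xu.
have yu := out_v _ (colored_arc_arc vy); rewrite yu in yq vy.
by rewrite (colored_arc_inj xu vy) in qx *; apply: connect_trans yq qx.
Qed.

Hypothesis D_not_C3 : ~ isomorphic D dicycle3.

(** A third vertex serves for [link_through] unless it is the end of a forced
    arc from [u] or the origin of one to [v], so it is enough to treat the
    digraphs in which all third vertices are of these two kinds. *)
Lemma link_across_forced_arc (u v : D) :
  forced_arc v u -> exists k, link c k u v.
Proof.
move=> vu_forced; have [vu in_u out_v] := vu_forced.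
have v_u := arc_neq vu; have u_v : u != v by rewrite eq_sym.
have [/arc_of[e [<- <-]]|not_uv] := boolP (arc u v).
  by exists (c e); apply/connect1/colored_arcP; exists e.
case: (pselect (exists k, link c k u v)) => [//|no_link]; exfalso.
have [w uw] := out_neighbor u_v; have [x xv] := in_neighbor u_v.
have w_v : w != v by apply: contraNneq not_uv => <-.
have x_u : x != u by apply: contraNneq not_uv => <-.
have w_u : w != u by rewrite eq_sym arc_neq.
have x_v := arc_neq xv.
have third z : z != u -> z != v -> forced_arc u z \/ forced_arc z v.
  move=> z_u z_v; have v_z : v != z by rewrite eq_sym.
  have [[k zu]|] := link_or_forced_arc z_u; last by left.
  have [[k' vz]|] := link_or_forced_arc v_z; last by right.
  by case: no_link; exists k; apply: link_through vu_forced _ _ zu vz.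
(* A forced arc [uz] is the only arc out of [u], so [z] is [w]; dually, a
   forced arc [zv] makes [z] equal to [x]. *)
have cover z : [|| z == u, z == v, z == w | z == x].
  have [//|z_u] := eqVneq z u; have [//|z_v] := eqVneq z v.
  case: (third z z_u z_v) => -[_ z1 z2]; first by rewrite (z2 w) ?eqxx.
  by rewrite (z1 x) ?eqxx ?orbT.
have not_wu : ~~ arc w u by apply: contraNN w_v => /in_u->.
have not_vw : ~~ arc v w by apply: contraNN w_u => /out_v->.
have [wx|w_x] := eqVneq w x.
  rewrite -wx in xv.
  apply: D_not_C3; apply: (@cycle3_isomorphic u v w) => //.
  by move=> z; have := cover z; rewrite -wx orbb.
(* From here on the digraph is the 4-cycle [v u w x]. *)
have [_ in_w out_u] : forced_arc u w.
  by case: (third w w_u w_v) => // -[_ /(_ x xv) xw]; rewrite xw eqxx in w_x.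
have [_ in_v out_x] : forced_arc x v.
  by case: (third x x_u x_v) => // -[_ _ /(_ w uw) xw]; rewrite xw eqxx in w_x.
have out_w z : arc w z -> z = x.
  move=> wz; case/or4P: (cover z) => /eqP z_eq //; rewrite z_eq in wz.
  - by rewrite wz in not_wu.
  - by rewrite (in_v w wz) eqxx in w_x.
  - by rewrite arc_irr in wz.
(* The arc [wx] is common to every walk from [u] to [x] and every walk from
   [w] to [v], so the two colors below agree. *)
have u_x : u != x by rewrite eq_sym.
have [[k ux]|[_ /(_ v vu) vx _]] := link_or_forced_arc u_x; last first.
  by rewrite vx eqxx in x_v.
have [[k' wv]|[vw _ _]] := link_or_forced_arc w_v; last by rewrite vw in not_vw.
have [y uy yx] := connect_first_step ux u_x.
have yw := out_u _ (colored_arc_arc uy); rewrite yw in uy yx.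
have [z wz _] := connect_first_step yx w_x.
have zx := out_w _ (colored_arc_arc wz); rewrite zx in wz.
have [t wt _] := connect_first_step wv w_v.
have tx := out_w _ (colored_arc_arc wt); rewrite tx in wt.
case: no_link; exists k; apply: connect_trans (connect1 uy) _.
by rewrite (colored_arc_inj wz wt).
Qed.

End ForcedArcs.

(** * Colorings of a digraph and of its line digraph *)

Lemma SVMC_line_digraph (D : digraph) (C : eqType) (c : arcs D -> C) :
    strong D -> ~ isomorphic D dicycle3 ->
  SVMC_coloring (D := line_digraph D) c <-> SMC_coloring c.
Proof.
move=> D_strong D_not_C3; split=> c_conn.
  suff conn u v : mono_connected c u v by move=> u v; split; apply: conn.
  apply/mono_connectedP; have [->|u_v] := eqVneq u v; [by left | right].
  have [//|] := link_or_forced_arc D_strong c_conn u_v.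
  exact: link_across_forced_arc.
suff conn e f : vmono_connected (D := line_digraph D) c e f.
  by move=> e f; split; apply: conn.
have [/mono_connectedP[ef|[k kef]] _] := c_conn (head e) (tail f); last first.
  exact: link_vmono kef.
by apply: (@link_vmono _ _ c (c e)); rewrite ef; apply: connect0.
Qed.

Theorem theorem5 (D : digraph) (D_strong : strong D)
    (D_not_C3 : ~ isomorphic D dicycle3) :
  smc_v (line_digraph D) = smc D.
Proof.
apply: eq_bigl => c; apply: asbool_equiv_eq.
exact: SVMC_line_digraph.
Qed.
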